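(* Let $p$ be an odd prime, let $\lambda\in\mathbb{Z}_p$ with $\lambda\neq 0$, let $q\in\mathbb{C}_p$ with $|1-q|_p<p^{-1/(p-1)}$, and let $x\in\mathbb{C}_p$. For every integer $m\ge 0$, $$\lambda^m E_m\left(\frac{x}{\lambda}\right)=\sum_{n=0}^m Bl_{n,q}(x|\lambda)\,q^{m-n}S_2(m,n),$$ and $$Bl_{m,q}(x|\lambda)=\sum_{\ell=0}^m S_1(m,\ell)\,q^{m-\ell}\lambda^\ell E_\ell\left(\frac{x}{\lambda}\right).$$
   Context: $\mathbb{Z}_p$ is the ring of $p$-adic integers and $\mathbb{C}_p$ is the completion of an algebraic closure of $\mathbb{Q}_p$, with norm normalized by $|p|_p=1/p$. For a continuous function $f$ on $\mathbb{Z}_p$ (with values in $\mathbb{C}_p$), the fermionic $p$-adic integral is $$\int_{\mathbb{Z}_p} f(y)\,d\mu_{-1}(y)=\lim_{N\to\infty}\sum_{y=0}^{p^N-1}f(y)(-1)^y.$$ The $q$-product is $(z)_{n,q}=z(z-q)(z-2q)\cdots(z-(n-1)q)$ for $n\ge 0$, with $(z)_{0,q}=1$, and $(z)_n=(z)_{n,1}$ is the falling factorial. The Boole polynomials with $q$-parameter are $$Bl_{n,q}(x|\lambda)=\int_{\mathbb{Z}_p}(x+\lambda y)_{n,q}\,d\mu_{-1}(y)\quad(n\ge 0).$$ The (signed) Stirling numbers of the first kind $S_1(n,\ell)$ and the Stirling numbers of the second kind $S_2(n,\ell)$ are defined by $(z)_n=\sum_{\ell=0}^n S_1(n,\ell)z^\ell$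 and $z^n=\sum_{\ell=0}^n S_2(n,\ell)(z)_\ell$. The Euler polynomials $E_n(z)$ are defined by $\frac{2}{e^t+1}e^{zt}=\sum_{n=0}^\infty E_n(z)\frac{t^n}{n!}$. *)

(* Defs.v *)
From HB Require Import structures.
From mathcomp Require Import all_boot all_order all_algebra.
From mathcomp Require Import all_classical all_reals all_analysis.
Import Order.TTheory GRing.Theory Num.Theory.
Import numFieldNormedType.Exports.

Set Implicit Arguments.
Unset Strict Implicit.
Unset Printing Implicit Defensive.

Local Open Scope classical_set_scope.
Local Open Scope ring_scope.

(* Neither Q_p nor C_p is in the libraries.  C_p is a field K with a
   real-valued absolute value v satisfying [is_Cp p v], i.e. K is the
   completion of an algebraic closure of Q_p; this determines (K, v) up to
   isometric isomorphism.  Q_p and its algebraic closure are subsets of K. *)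
Section PadicComplex.
Variables (R : realType) (p : nat) (K : fieldType) (v : K -> R).

Definition vcvg (u : nat -> K) (l : K) : Prop :=
  v (u n - l) @[n --> \oo] --> (0 : R).

Definition vcauchy (u : nat -> K) : Prop :=
  forall e : R, 0 < e ->
    exists N, forall m n, (N <= m)%N -> (N <= n)%N -> v (u m - u n) < e.

(* The completion of the rationals inside the complete field K. *)
Definition Q_p : set K :=
  [set y | exists u : nat -> rat, vcvg (fun n => ratr (u n)) y].

Definition Z_p : set K := [set y | Q_p y /\ v y <= 1].

Definition Qbar_p : set K :=
  [set y | exists P : {poly K}, [/\ P != 0, forall i, Q_p P`_i & root P y]].

(* The normalization of [v p] and the ultrametric inequality force the
   characteristic to be 0 and v to be the p-adic absolute value on rationals. *)
Record is_Cp : Prop := IsCp {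
  Cp_ge0 : forall x, 0 <= v x;
  Cp_eq0 : forall x, v x = 0 <-> x = 0;
  Cp_mul : forall x y, v (x * y) = v x * v y;
  Cp_ultra : forall x y, v (x + y) <= Num.max (v x) (v y);
  Cp_norm : v p%:R = p%:R^-1;
  Cp_closed : forall P : {poly K}, (1 < size P)%N ->
    (forall i, Qbar_p P`_i) -> exists2 y, Qbar_p y & root P y;
  Cp_dense : forall x, exists2 u : nat -> K, forall n, Qbar_p (u n) & vcvg u x;
  Cp_complete : forall u, vcauchy u -> exists l, vcvg u l
}.

(* Only the values of f at natural numbers matter, so an integrand on Z_p is
   represented by any function on K extending it.  The value is 0 when the
   limit does not exist. *)
Definition fermionic_sum (f : K -> K) (N : nat) : K :=
  \sum_(0 <= y < p ^ N) f y%:R * (-1) ^+ y.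

Definition fermionic_integral (f : K -> K) : K :=
  xget 0 [set l | vcvg (fermionic_sum f) l].

Lemma vcvg_unique (u : nat -> K) (l1 l2 : K) :
  is_Cp -> vcvg u l1 -> vcvg u l2 -> l1 = l2.
Proof.
move=> H c1 c2.
have vN1 : v (-1) = 1.
  have v11 : v 1 * v 1 = v 1 by rewrite -(Cp_mul H) mulr1.
  have v1N0 : v 1 != 0.
    by apply/eqP => /(Cp_eq0 H)/eqP; rewrite oner_eq0.
  have v1 : v 1 = 1 by apply: (mulfI v1N0); rewrite v11 mulr1.
  have /eqP : v (-1) ^+ 2 = 1 by rewrite expr2 -(Cp_mul H) mulrNN mulr1.
  by rewrite sqrp_eq1 ?(Cp_ge0 H)// => /eqP.
have vle n : v (l1 - l2) <= v (u n - l1) + v (u n - l2).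
  have -> : l1 - l2 = -1 * (u n - l1) + (u n - l2).
    by rewrite mulN1r opprB addrA subrK.
  apply: (le_trans (Cp_ultra H _ _)); rewrite (Cp_mul H) vN1 mul1r.
  by rewrite ge_max lerDl lerDr !(Cp_ge0 H).
have v0 : v (l1 - l2) <= 0.
  have c : (fun n => v (u n - l1) + v (u n - l2)) @ \oo --> (0 + 0 : R).
    exact: cvgD c1 c2.
  rewrite -[leRHS]addr0 -(cvg_lim _ c)//.
  apply: limr_ge; first by apply/cvg_ex; exists (0 + 0).
  exact: nearW.
apply/eqP; rewrite -subr_eq0; apply/eqP/(Cp_eq0 H)/eqP.
by rewrite eq_le v0 (Cp_ge0 H).
Qed.

Lemma fermionic_integralE (f : K -> K) (l : K) :
  is_Cp -> vcvg (fermionic_sum f) l -> fermionic_integral f = l.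
Proof.
by move=> H cl; apply: xget_unique => // y cy; apply: vcvg_unique H cy cl.
Qed.

End PadicComplex.

Definition qprod (A : pzRingType) (q z : A) (n : nat) : A :=
  \prod_(0 <= i < n) (z - i%:R * q).

Definition falling (A : pzRingType) (z : A) (n : nat) : A := qprod 1 z n.

Definition boole (R : realType) (p : nat) (K : fieldType) (v : K -> R)
    (q lambda : K) (n : nat) (x : K) : K :=
  fermionic_integral p v (fun y => qprod q (x + lambda * y) n).

Definition stirling1 (n l : nat) : int := (falling ('X : {poly int}) n)`_l.

Lemma stirling1E (n : nat) :
  falling ('X : {poly int}) n = \sum_(l < n.+1) stirling1 n l *: 'X^l.
Proof.
rewrite -(poly_def n.+1 (stirling1 n)); apply/polyP => i.
rewrite coef_poly /stirling1; case: ltnP => // ni; apply: nth_default.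
apply: leq_trans ni; rewrite /falling /qprod.
elim: n => [|n IH]; first by rewrite big_nil size_poly1.
rewrite big_nat_recr//=; apply: (leq_trans (size_polyMleq _ _)).
have s2 : (size ('X - n%:R * 1 : {poly int})%R <= 2)%N.
  by rewrite mulr1 -polyC_natr size_XsubC.
by rewrite -subn1 leq_subLR add1n -addn2 (leq_trans (leq_add IH s2))// addn2.
Qed.

(* S_2(n, -) is packed as the coefficient sequence of a polynomial. *)
Lemma stirling2_exists (n : nat) : exists s : {poly int}, (size s <= n.+1)%N &&
  ('X^n == \sum_(l < n.+1) s`_l *: falling ('X : {poly int}) l).
Proof.
have fallS l : falling ('X : {poly int}) l.+1
    = 'X * falling 'X l - l%:R *: falling 'X l.
  rewrite /falling /qprod big_nat_recr//= mulr1 mulrC mulrBl.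
  by rewrite scaler_nat mulr_natl.
elim: n => [|n [s /andP[ss /eqP IH]]].
  exists 1; rewrite size_poly1 leqnn big_ord1 coef1 scale1r.
  by rewrite /falling /qprod big_nil expr0 eqxx.
exists ('X * (s + s^`())); apply/andP; split.
  apply: (leq_trans (size_polyMleq _ _)); rewrite size_polyX /= ltnS.
  apply: (leq_trans (size_polyD _ _)); rewrite geq_max ss /=.
  exact: leq_trans (leq_trans (size_poly _ _) (leq_pred _)) ss.
rewrite big_ord_recl coefXM eqxx scale0r add0r exprS IH mulr_sumr.
under eq_bigr => l _.
  rewrite -scalerAr.
  have -> : 'X * falling ('X : {poly int}) l
      = falling 'X l.+1 + l%:R *: falling 'X l by rewrite fallS subrK.
  rewrite scalerDr scalerA; over.
under [X in _ == X]eq_bigr => l _.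
  rewrite coefXM /= coefD coef_deriv scalerDl; over.
rewrite !big_split /= (inj_eq (addrI _)).
rewrite big_ord_recl mulr0 scale0r add0r [X in _ == X]big_ord_recr /=.
rewrite [s`_n.+1]nth_default// mul0rn scale0r addr0.
by apply/eqP/eq_bigr => l _; rewrite mulr_natr.
Qed.

Definition stirling2 (n l : nat) : int := (xchoose (stirling2_exists n))`_l.

Lemma stirling2E (n : nat) :
  'X^n = \sum_(l < n.+1) stirling2 n l *: falling ('X : {poly int}) l.
Proof. by have /andP[_ /eqP] := xchooseP (stirling2_exists n). Qed.

(* A formal power series over A is its coefficient sequence nat -> A. *)
Section FormalPowerSeries.
Variable A : comUnitRingType.
Implicit Types a b : nat -> A.

Definition fps_const (c : A) (n : nat) : A := if n == 0%N then c else 0.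
Definition fps_add a b (n : nat) : A := a n + b n.
Definition fps_mul a b (n : nat) : A := \sum_(i < n.+1) a i * b (n - i)%N.

(* The series e^(c t). *)
Definition fps_exp (c : A) (n : nat) : A := c ^+ n / n`!%:R.

(* The first n coefficients of 1 / a. *)
Fixpoint fps_inv_seq a (n : nat) : seq A :=
  if n is k.+1 then
    let s := fps_inv_seq a k in
    rcons s ((a 0%N)^-1 *
             ((k == 0%N)%:R - \sum_(i < k) a i.+1 * s`_(k - i.+1)))
  else [::].
Definition fps_inv a (n : nat) : A := (fps_inv_seq a n.+1)`_n.

Lemma fps_mulrV a : a 0%N \is a GRing.unit ->
  fps_mul a (fps_inv a) = fps_const 1.
Proof.
move=> ua; apply/funext => n.
have size_inv k : size (fps_inv_seq a k) = k.
  by elim: k => //= k IH; rewrite size_rcons IH.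
have inv_nth k i : (i < k)%N -> (fps_inv_seq a k)`_i = fps_inv a i.
  elim: k => // k IH; rewrite ltnS leq_eqVlt => /orP[/eqP -> //|ik] /=.
  by rewrite nth_rcons size_inv ik IH.
rewrite /fps_mul big_ord_recl subn0.
rewrite {1}/fps_inv /= nth_rcons size_inv ltnn eqxx mulrA mulrV// mul1r.
under [X in _ - X]eq_bigr => i _.
  rewrite inv_nth; last by rewrite ltn_subrL /= (leq_ltn_trans _ (ltn_ord i)).
  over.
by rewrite subrK /fps_const; case: (n == 0%N).
Qed.

End FormalPowerSeries.

(* E_n as n! times the coefficient of t^n in 2 / (e^t + 1) * e^(X t), a formal
   power series with coefficients in F[X]; F must have characteristic 0. *)
Definition euler_poly (F : fieldType) (n : nat) : {poly F} :=
  n`!%:R * fps_mul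
    (fps_mul (fps_const 2%:R)
       (fps_inv (fps_add (fps_exp (1 : {poly F})) (fps_const 1))))
    (fps_exp 'X) n.

(* Main.v *)
Require Import Defs.
From HB Require Import structures.
From mathcomp Require Import all_boot all_order all_algebra.
From mathcomp Require Import all_classical all_reals all_analysis.
From mathcomp Require Import ring.
Import Order.TTheory GRing.Theory Num.Theory.
Import numFieldNormedType.Exports.
Local Open Scope ring_scope.

(** The theorem rests on the moment formula: the fermionic integral of
    (x + lambda y)^n over y is lambda^n E_n(x / lambda)
    ([vcvg_fermionic_sum_expr]).  Both formulas follow from it, since they
    are the polynomial identities
      (z)_{n,q} = sum_l S_1(n, l) q^(n-l) z^l,
      z^n = sum_l S_2(n, l) q^(n-l) (z)_{l,q}
    ([qprod_stirling1], [expr_stirling2]) taken at z = x + lambda y and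
    integrated term by term.

    The moments come from a telescoping argument.  If P is a polynomial with
    P(y) + P(y + 1) = 2 f(y), then, p^N being odd, the alternating sum of f
    over 0 <= y < p^N is (P(0) + P(p^N)) / 2.  Since p^N tends to 0 and
    polynomials are continuous, the integral of f is P(0)
    ([vcvg_fermionic_sum_poly]).  For f(y) = (x + lambda y)^n one takes
    P(y) = lambda^n E_n(x / lambda + y), because of the functional equation
    E_n(z) + E_n(z + 1) = 2 z^n ([euler_polyD1]).

    That equation says (2 / (e^t + 1)) (e^(zt) + e^((z+1)t)) = 2 e^(zt), a
    consequence of e^((z+1)t) = e^(zt) e^t. *)

(** * Formal power series *)

Section FormalPowerSeriesTheory.
Variable A : comUnitRingType.
Implicit Types a b c : nat -> A.

(** Truncation to polynomials transfers the ring laws of polynomials to the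
    product of series, since each coefficient of a product depends on finitely
    many coefficients of the factors. *)
Definition fps_trunc (n : nat) a : {poly A} := \poly_(i < n.+1) a i.

Lemma coef_fps_trunc n a k : (k <= n)%N -> (fps_trunc n a)`_k = a k.
Proof. by move=> kn; rewrite coef_poly ltnS kn. Qed.

Lemma coef_fps_mul n a b k : (k <= n)%N ->
  fps_mul a b k = (fps_trunc n a * fps_trunc n b)`_k.
Proof.
move=> kn; rewrite coefM; apply: eq_bigr => -[i /= ik] _.
by rewrite !coef_fps_trunc// (leq_trans _ kn) ?leq_subr.
Qed.

Lemma fps_mulC a b : fps_mul a b = fps_mul b a.
Proof. by apply/funext => n; rewrite !(@coef_fps_mul n)// mulrC. Qed.

Lemma fps_mulA a b c : fps_mul a (fps_mul b c) = fps_mul (fps_mul a b) c.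
Proof.
apply/funext => n.
have mulE a' b' c' : fps_mul a' (fps_mul b' c') n
    = (fps_trunc n a' * (fps_trunc n b' * fps_trunc n c'))`_n.
  rewrite coefM; apply: eq_bigr => -[i /= ik] _.
  by rewrite coef_fps_trunc// (@coef_fps_mul n)// leq_subr.
by rewrite mulE fps_mulC mulE mulrA [in RHS]mulrC.
Qed.

Lemma fps_mulDr a b c :
  fps_mul a (fps_add b c) = fps_add (fps_mul a b) (fps_mul a c).
Proof.
apply/funext => n; rewrite /fps_add /fps_mul -big_split.
by apply: eq_bigr => i _; rewrite mulrDr.
Qed.

Lemma fps_mul_constl k a n : fps_mul (fps_const k) a n = k * a n.
Proof.
rewrite /fps_mul big_ord_recl /fps_const /= subn0 big1 ?addr0// => i _.
by rewrite mul0r.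
Qed.

Lemma fps_mul1l a : fps_mul (fps_const 1) a = a.
Proof. by apply/funext => n; rewrite fps_mul_constl mul1r. Qed.

Lemma fps_inv_unique a b c : fps_mul a b = fps_const 1 ->
  fps_mul a c = fps_const 1 -> b = c.
Proof.
move=> ab ac; rewrite -[b]fps_mul1l -ac -fps_mulA [fps_mul c b]fps_mulC.
by rewrite fps_mulA ab fps_mul1l.
Qed.

End FormalPowerSeriesTheory.

(** * The functional equation of the Euler polynomials *)

Section EulerPolynomials.
Variables (F : fieldType) (F_pchar0 : [pchar F] =i pred0).

Lemma fact_neq0 n : n`!%:R != 0 :> F.
Proof. by rewrite ((pcharf0P F).1 F_pchar0) -lt0n fact_gt0. Qed.

Lemma fps_expD (c d : F) : fps_mul (fps_exp c) (fps_exp d) = fps_exp (c + d).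
Proof.
apply/funext => n; rewrite /fps_exp [c + d]addrC exprDn mulr_suml.
apply: eq_bigr => -[i /=]; rewrite ltnS => le_in _.
rewrite mulrACA [c ^+ i * _]mulrC -[_ *+ 'C(n, i)]mulr_natr -[RHS]mulrA.
congr (_ * _).
have bin_neq0 : 'C(n, i)%:R != 0 :> F.
  by rewrite ((pcharf0P F).1 F_pchar0) -lt0n bin_gt0.
rewrite -(bin_fact le_in) !natrM !invfM.
by rewrite mulVKf.
Qed.

Lemma horner_fps_mul (z : F) (a b : nat -> {poly F}) :
  (fun n => (fps_mul a b n).[z])
  = fps_mul (fun n => (a n).[z]) (fun n => (b n).[z]).
Proof.
apply/funext => n; rewrite horner_sum.
by apply: eq_bigr => i _; rewrite hornerM.
Qed.

Lemma horner_fps_exp (z : F) (c : {poly F}) :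
  (fun n => (fps_exp c n).[z]) = fps_exp c.[z].
Proof.
apply/funext => n.
by rewrite /fps_exp -polyC_natr polyCV hornerM hornerC horner_exp.
Qed.

Lemma horner_fps_const (z : F) (c : {poly F}) :
  (fun n => (fps_const c n).[z]) = fps_const c.[z].
Proof. by apply/funext => -[|n]; rewrite /fps_const ?horner0. Qed.

Definition euler_denom (A : comUnitRingType) : nat -> A :=
  fps_add (fps_exp 1) (fps_const 1).

Lemma horner_euler_denom (z : F) :
  (fun n => (euler_denom {poly F} n).[z]) = euler_denom F.
Proof.
apply/funext => n; rewrite /euler_denom /fps_add hornerD.
rewrite [X in X + _](congr1 (@^~ n) (horner_fps_exp z 1)).
by rewrite [X in _ + X](congr1 (@^~ n) (horner_fps_const z 1)) !hornerC.
Qed.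

(** Evaluation at z is a ring morphism F[X] -> F that preserves e^t + 1, hence
    it preserves the identity defining the inverse, which exists because the
    constant coefficient 2 is invertible in characteristic 0. *)
Lemma euler_denom_mulV (z : F) :
  fps_mul (euler_denom F) (fun n => (fps_inv (euler_denom {poly F}) n).[z])
  = fps_const 1.
Proof.
rewrite -[in LHS](horner_euler_denom z) -horner_fps_mul fps_mulrV.
  by rewrite horner_fps_const hornerC.
rewrite /euler_denom /fps_add /fps_exp /fps_const /= expr0 fact0 divr1.
rewrite -[1 + 1]/(2%:R) -polyC_natr rmorph_unit// unitfE.
by rewrite ((pcharf0P F).1 F_pchar0).
Qed.

(** By uniqueness of inverses, the coefficients of 1 / (e^t + 1) take the same
    value at z as at 0, so z enters E_n(z) only through e^(z t).  Hence series
    attached to different points can be compared. *)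
Lemma horner_euler_poly n (z : F) : (euler_poly F n).[z] =
  n`!%:R * fps_mul (fps_mul (fps_const 2%:R)
     (fun k => (fps_inv (euler_denom {poly F}) k).[0])) (fps_exp z) n.
Proof.
rewrite /euler_poly hornerM -polyC_natr hornerC; congr (_ * _).
rewrite [LHS](congr1 (@^~ n) (horner_fps_mul z _ _)) horner_fps_mul.
rewrite horner_fps_const horner_fps_exp hornerX -polyC_natr hornerC.
congr (fps_mul (fps_mul _ _) _ n).
exact: fps_inv_unique (euler_denom_mulV z) (euler_denom_mulV 0).
Qed.

Lemma euler_polyD1 n (z : F) :
  (euler_poly F n).[z] + (euler_poly F n).[z + 1] = 2%:R * z ^+ n.
Proof.
rewrite !horner_euler_poly -mulrDr; set a := fps_mul (fps_const _) _.
(* a = 2 / (e^t + 1), and e^(z t) + e^((z + 1) t) = (e^t + 1) e^(z t). *)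
have -> : fps_mul a (fps_exp z) n + fps_mul a (fps_exp (z + 1)) n
    = fps_mul a (fps_mul (euler_denom F) (fps_exp z)) n.
  rewrite [fps_mul (euler_denom F) _]fps_mulC fps_mulDr fps_expD.
  rewrite [fps_mul (fps_exp z) _]fps_mulC fps_mul1l fps_mulDr.
  exact: addrC.
have aD : fps_mul a (euler_denom F) = fps_const 2%:R.
  rewrite /a -fps_mulA [fps_mul _ (euler_denom F)]fps_mulC euler_denom_mulV.
  by rewrite fps_mulC fps_mul1l.
rewrite fps_mulA aD fps_mul_constl mulrCA; congr (_ * _).
by rewrite mulrC divfK ?fact_neq0.
Qed.

End EulerPolynomials.

(** * Stirling expansions of the q-product *)

Section Stirling.
Variables (F : fieldType) (q : F) (q_neq0 : q != 0).

(** This rescaling reduces the expansions in (z)_{n,q} to the integral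
    polynomial identities for falling factorials, evaluated at z / q. *)
Lemma qprod_falling (z : F) n : qprod q z n = q ^+ n * falling (z / q) n.
Proof.
rewrite /falling /qprod -[n in q ^+ n]subn0 -prodr_const_nat -big_split.
apply: eq_bigr => i _ /=.
by rewrite mulr1 mulrBr mulrCA mulfV// mulr1 [q * _]mulrC.
Qed.

Lemma horner_falling (z : F) n :
  (map_poly intr (falling ('X : {poly int}) n)).[z] = falling z n.
Proof.
rewrite /falling /qprod rmorph_prod horner_prod; apply: eq_bigr => i _.
rewrite !mulr1 rmorphB /= map_polyX rmorph_nat.
by rewrite -polyC_natr hornerXsubC.
Qed.

Lemma qprod_stirling1 (z : F) n : qprod q z n =
  \sum_(l < n.+1) (stirling1 n l)%:~R * q ^+ (n - l) * z ^+ l.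
Proof.
rewrite qprod_falling -horner_falling stirling1E rmorph_sum horner_sum.
rewrite mulr_sumr; apply: eq_bigr => -[l /=]; rewrite ltnS => le_ln _.
rewrite map_polyZ map_polyXn hornerZ hornerXn mulrCA -mulrA; congr (_ * _).
by rewrite -[in LHS](subnK le_ln) exprD -mulrA -exprMn mulrCA mulfV// mulr1.
Qed.

Lemma expr_stirling2 (z : F) n : z ^+ n =
  \sum_(l < n.+1) qprod q z l * q ^+ (n - l) * (stirling2 n l)%:~R.
Proof.
have -> : z ^+ n = q ^+ n * (map_poly intr ('X^n : {poly int})).[z / q].
  by rewrite map_polyXn hornerXn -exprMn mulrCA mulfV// mulr1.
rewrite stirling2E rmorph_sum horner_sum mulr_sumr.
apply: eq_bigr => -[l /=]; rewrite ltnS => le_ln _.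
rewrite map_polyZ hornerZ horner_falling qprod_falling.
by rewrite -{1}(subnK le_ln) exprD; ring.
Qed.

End Stirling.

(** * Fermionic integrals of polynomials *)

Section FermionicIntegral.
Variables (R : realType) (p : nat) (K : fieldType) (v : K -> R).
Hypotheses (p_prime : prime p) (vP : is_Cp p v).

Let v_ge0 := Cp_ge0 vP.
Let vM := Cp_mul vP.

Lemma Cp_v0 : v 0 = 0.
Proof. exact/(Cp_eq0 vP). Qed.

Lemma Cp_v1 : v 1 = 1.
Proof.
have v1_neq0 : v 1 != 0.
  by apply/eqP => /(Cp_eq0 vP)/eqP; rewrite oner_eq0.
by apply: (mulfI v1_neq0); rewrite -vM !mulr1.
Qed.

Lemma Cp_vN x : v (- x) = v x.
Proof.
have /eqP : v (-1) ^+ 2 = 1 by rewrite expr2 -vM mulrNN mulr1 Cp_v1.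
by rewrite sqrp_eq1// => /eqP vN1; rewrite -mulN1r vM vN1 mul1r.
Qed.

Lemma Cp_vX x n : v (x ^+ n) = v x ^+ n.
Proof. by elim: n => [|n IH]; rewrite ?Cp_v1// !exprS vM IH. Qed.

Lemma Cp_vD x y : v (x + y) <= v x + v y.
Proof.
by apply: (le_trans (Cp_ultra vP x y)); rewrite ge_max lerDl lerDr !v_ge0.
Qed.

Lemma Cp_v_nat_le1 n : v n%:R <= 1.
Proof.
elim: n => [|n IH]; first by rewrite Cp_v0.
rewrite -natr1; apply: (le_trans (Cp_ultra vP _ _)).
by rewrite ge_max IH Cp_v1 lexx.
Qed.

Lemma Cp_vp_lt1 : v p%:R < 1.
Proof. by rewrite (Cp_norm vP) invf_lt1 ?ltr0n ?ltr1n ?prime_gt1 ?prime_gt0. Qed.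

(** If a prime r vanishes in K then r differs from p, as v p is nonzero, and a
    Bezout relation writes 1 as an integer multiple of p in K, which forces
    v 1 < 1. *)
Lemma Cp_pchar0 : [pchar K] =i pred0.
Proof.
move=> r; rewrite !inE; apply/negP => /andP[r_prime r0].
have [a _ r_dvd] := Bezoutl p (prime_gt0 r_prime).
have rp : coprime r p.
  rewrite prime_coprime// dvdn_prime2//; apply/eqP => r_eq_p.
  have := Cp_norm vP; rewrite -r_eq_p (eqP r0) Cp_v0 => /esym/eqP.
  by rewrite invr_eq0 pnatr_eq0 gtn_eqF ?prime_gt0.
move: r_dvd; rewrite (eqP rp) => /dvdnP[c ac].
have one_eq : 1 = - (a%:R * p%:R) :> K.
  apply/eqP; rewrite -addr_eq0 -natrM nat1r -add1n ac natrM (eqP r0).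
  by rewrite mulr0.
have : v 1 < 1.
  rewrite one_eq Cp_vN vM; apply: le_lt_trans Cp_vp_lt1.
  by rewrite ler_piMl// Cp_v_nat_le1.
by rewrite Cp_v1 ltxx.
Qed.

Lemma vcvg_le (u : nat -> K) l (b : nat -> R) :
  (forall n, v (u n - l) <= b n) -> (b n @[n --> \oo] --> (0 : R))%classic ->
  vcvg v u l.
Proof.
move=> ub b0; apply: (squeeze_cvgr _ (cvg_cst 0) b0).
by apply: nearW => n; rewrite v_ge0 ub.
Qed.

Lemma vcvg0 : vcvg v (fun=> 0) 0.
Proof.
by apply: (@vcvg_le _ _ (fun=> 0)) (cvg_cst _) => n; rewrite subr0 Cp_v0.
Qed.

Lemma vcvgD (u w : nat -> K) k l :
  vcvg v u k -> vcvg v w l -> vcvg v (fun n => u n + w n) (k + l).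
Proof.
move=> uk wl; apply: (@vcvg_le _ _ (fun n => v (u n - k) + v (w n - l))).
  by move=> n; rewrite opprD addrACA Cp_vD.
by have := cvgD uk wl; rewrite addr0; apply.
Qed.

Lemma vcvgZ c (u : nat -> K) l :
  vcvg v u l -> vcvg v (fun n => c * u n) (c * l).
Proof.
move=> ul; apply: (@vcvg_le _ _ (fun n => v c * v (u n - l))).
  by move=> n; rewrite -mulrBr vM.
by have := cvgM (cvg_cst (v c)) ul; rewrite mulr0; apply.
Qed.

Lemma horner_bounded (P : {poly K}) :
  exists M, forall h, v h <= 1 -> v P.[h] <= M.
Proof.
elim/poly_ind: P => [|P c [M PM]].
  by exists 0 => h _; rewrite horner0 Cp_v0.
exists (M + v c) => h h1; rewrite hornerMXaddC.
apply: le_trans (Cp_vD _ _) _; rewrite lerD2r vM.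
by apply: le_trans (PM h h1); rewrite ler_piMr.
Qed.

(** Writing P = Q X + c gives P(p^N) - P(0) = Q(p^N) p^N, where Q is bounded on
    the unit ball. *)
Lemma vcvg_horner_pX (P : {poly K}) :
  vcvg v (fun N => P.[(p ^ N)%:R]) P.[0].
Proof.
elim/poly_ind: P => [|P c _].
  by rewrite horner0; under eq_fun do rewrite horner0; exact: vcvg0.
have [M PM] := horner_bounded P.
apply: (@vcvg_le _ _ (fun N => M * v p%:R ^+ N)) => [N|].
  rewrite !hornerMXaddC mulr0 add0r addrK vM natrX Cp_vX ler_wpM2r ?exprn_ge0//.
  by rewrite -natrX PM// Cp_v_nat_le1.
have p0 : (v p%:R ^+ N @[N --> \oo] --> (0 : R))%classic.
  by apply: cvg_expr; rewrite ger0_norm// Cp_vp_lt1.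
by have := cvgM (cvg_cst M) p0; rewrite mulr0; apply.
Qed.

Lemma alternating_sum_telescope (f g : nat -> K) M :
  (forall y, g y + g y.+1 = 2%:R * f y) ->
  2%:R * \sum_(0 <= y < M) f y * (-1) ^+ y = g 0%N - (-1) ^+ M * g M.
Proof.
move=> fg; elim: M => [|M IH]; first by rewrite big_nil mulr0 mul1r subrr.
rewrite big_nat_recr//= mulrDr IH mulrA -fg exprS; ring.
Qed.

(** As p^N is odd, telescoping leaves (P(0) + P(p^N)) / 2, and P(p^N) tends
    to P(0). *)
Lemma vcvg_fermionic_sum_poly (f : K -> K) (P : {poly K}) : odd p ->
  (forall y : nat, P.[y%:R] + P.[y%:R + 1] = 2%:R * f y%:R) ->
  vcvg v (fermionic_sum p f) P.[0].
Proof.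
move=> p_odd fP; have two_neq0 : 2%:R != 0 :> K.
  by rewrite ((pcharf0P K).1 Cp_pchar0).
have -> : fermionic_sum p f =
    fun N => 2%:R^-1 * P.[0] + 2%:R^-1 * P.[(p ^ N)%:R].
  apply/funext => N; apply: (mulfI two_neq0); rewrite -mulrDr mulVKf//.
  rewrite /fermionic_sum.
  rewrite (@alternating_sum_telescope (fun y => f y%:R) (fun y => P.[y%:R])).
    by rewrite -signr_odd oddX p_odd orbT expr1 mulN1r opprK.
  by move=> y; rewrite -natr1.
have half_two : 2%:R^-1 * P.[0] + 2%:R^-1 * P.[0] = P.[0].
  by rewrite -mulrDr -mulr2n -[P.[0] *+ 2]mulr_natl mulKf.
rewrite -[X in vcvg _ _ X]half_two; apply: vcvgD.
  apply: (@vcvg_le _ _ (fun=> 0)) (cvg_cst _) => N.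
  by rewrite subrr Cp_v0.
exact/vcvgZ/vcvg_horner_pX.
Qed.

(** Linearity is stated for limits rather than for [fermionic_integral], which
    need not be additive on integrands whose sums diverge. *)
Lemma vcvg_fermionic_sum_lincomb (I : Type) (r : seq I) (c : I -> K)
    (f : I -> K -> K) (l : I -> K) :
  (forall i, vcvg v (fermionic_sum p (f i)) (l i)) ->
  vcvg v (fermionic_sum p (fun y => \sum_(i <- r) c i * f i y))
    (\sum_(i <- r) c i * l i).
Proof.
move=> fl; elim: r => [|i r IH].
  rewrite big_nil (_ : fermionic_sum _ _ = fun=> 0); first exact: vcvg0.
  apply/funext => N; rewrite /fermionic_sum big1// => y _.
  by rewrite big_nil mul0r.
rewrite big_cons; set g := fun y => \sum_(j <- r) _ in IH.
rewrite (_ : fermionic_sum _ _ =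
    fun N => c i * fermionic_sum p (f i) N + fermionic_sum p g N).
  exact: vcvgD (vcvgZ _ _ _ (fl i)) IH.
apply/funext => N; rewrite /fermionic_sum mulr_sumr -big_split.
by apply: eq_bigr => y _; rewrite big_cons mulrDl mulrA.
Qed.

Lemma vcvg_fermionic_sum_expr (x lambda : K) n : odd p -> lambda != 0 ->
  vcvg v (fermionic_sum p (fun y => (x + lambda * y) ^+ n))
    (lambda ^+ n * (euler_poly K n).[x / lambda]).
Proof.
move=> p_odd l0.
(* Shifting E_n by x / lambda turns its functional equation into that of P. *)
pose P := lambda ^+ n *: (euler_poly K n \Po ('X + (x / lambda)%:P)).
have PE y : P.[y] = lambda ^+ n * (euler_poly K n).[x / lambda + y].
  by rewrite hornerZ horner_comp hornerD hornerX hornerC addrC.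
rewrite -[x / lambda]addr0 -PE; clearbody P.
apply: (vcvg_fermionic_sum_poly _ P p_odd) => y.
rewrite !PE addrA -mulrDr euler_polyD1; last exact: Cp_pchar0.
by rewrite mulrCA -exprMn mulrDr mulrCA mulfV// mulr1.
Qed.

End FermionicIntegral.

Theorem theorem2p2 (R : realType) (p : nat) (Cp : fieldType) (vp : Cp -> R)
    (p_prime : prime p) (p_odd : odd p) (CpP : is_Cp p vp)
    (lambda : Cp) (lambda_Z_p : Z_p vp lambda) (lambda_neq0 : lambda != 0)
    (q : Cp) (q_near1 : vp (1 - q) < p%:R `^ (- (p.-1%:R)^-1))
    (x : Cp) (m : nat) :
  lambda ^+ m * (euler_poly Cp m).[x / lambda] =
    \sum_(0 <= n < m.+1)
      boole p vp q lambda n x * q ^+ (m - n) * (stirling2 m n)%:~R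
  /\
  boole p vp q lambda m x =
    \sum_(0 <= l < m.+1)
      (stirling1 m l)%:~R * q ^+ (m - l) * lambda ^+ l
        * (euler_poly Cp l).[x / lambda].
Proof.
have q_neq0 : q != 0.
  (* p ^ (- 1 / (p - 1)) <= 1, whereas q = 0 would give vp (1 - q) = 1. *)
  apply/eqP => q0; move: q_near1; rewrite q0 subr0 (Cp_v1 _ _ _ _ CpP) powRN.
  rewrite ltNge invf_le1 ?powR_gt0 ?ltr0n ?prime_gt0// -[leLHS](powRr0 p%:R).
  by rewrite ler_powR ?ler1n ?prime_gt0// invr_ge0.
have moment n :=
  vcvg_fermionic_sum_expr R p Cp vp p_prime CpP x lambda n p_odd lambda_neq0.
have boole_cvg n : vcvg vp
    (fermionic_sum p (fun y => qprod q (x + lambda * y) n))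
    (\sum_(l < n.+1) (stirling1 n l)%:~R * q ^+ (n - l)
       * (lambda ^+ l * (euler_poly Cp l).[x / lambda])).
  under eq_fun do rewrite qprod_stirling1//.
  exact: vcvg_fermionic_sum_lincomb.
have booleE n := fermionic_integralE CpP (boole_cvg n).
split; rewrite big_mkord; last first.
  by rewrite [LHS]booleE; apply: eq_bigr => l _; exact: mulrA.
(* The sums of (x + lambda y)^m converge to both sides of the first formula:
   to the left one by the moment formula, and to the right one through the
   expansion in q-products. *)
apply: (vcvg_unique CpP (moment m)).
have -> : (fun y : Cp => (x + lambda * y) ^+ m) = fun y =>
    \sum_(n < m.+1) (q ^+ (m - n) * (stirling2 m n)%:~R)
      * qprod q (x + lambda * y) n.
  apply/funext => y; rewrite (expr_stirling2 _ _ q_neq0).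
  by apply: eq_bigr => n _; rewrite -mulrA mulrC.
under [X in vcvg _ _ X]eq_bigr do rewrite -mulrA mulrC.
apply: vcvg_fermionic_sum_lincomb => // n.
by rewrite [boole _ _ _ _ _ _]booleE; exact: boole_cvg.
Qed.
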